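(* Let $N=\langle S,T,F,\mathsf m\rangle$ be a complete unravel net and let $U\subseteq T$ be the set of transitions to be reversed. Define $\overleftarrow{N}^{U}=\langle S',T',U',F',\mathsf m'\rangle$ by $S'=S$, $U'=U\times\{\mathtt r\}$, $T'=(T\times\{\mathtt f\})\cup U'$, $\mathsf m'=\mathsf m$ and $$F'=\{(s,(t,\mathtt f))\mid (s,t)\in F\}\cup\{((t,\mathtt f),s)\mid (t,s)\in F\}\cup\{(s,(t,\mathtt r))\mid (t,s)\in F,\ t\in U\}\cup\{((t,\mathtt r),s)\mid (s,t)\in F,\ t\in U\}.$$ Then $\overleftarrow{N}^{U}$ is a reversible unravel net.
   Context: A Petri net is $N=\langle S,T,F,\mathsf m\rangle$ with places $S$, transitions $T$ ($S\cap T=\emptyset$), flow $F\subseteq (S\times T)\cup(T\times S)$ and initial marking $\mathsf m$, a multiset over $S$. ${}^\bullet x=\{y\mid (y,x)\in F\}$, $x^\bullet=\{y\mid (x,y)\in F\}$; ${}^\bullet t\ne\emptyset$ for all $t\in T$. $t$ is enabled at a marking $\mathsf m$ if ${}^\bullet t\subseteq\mathsf m$, and then it can fire, producing $\mathsf m-{}^\bullet t+t^\bullet$. An execution of $N$ is the multiset of transitions of a firing sequence starting at the initial marking. $N$ is safe if every reachable marking is a set (at most one token per place). For $T'\subseteq T$, the subnet $N|_{T'}$ generated by $T'$ has transitions $T'$, places ${}^\bullet T'\cup T'^\bullet$, and the flow and initial marking of $N$ restricted to these. A causal net is a safe net in which every place has at most one input and at most one output transition, $F^*$ is acyclic, $T$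 is an execution, and every place with empty preset is marked by one token. An unravel net is a safe net such that (1) $N|_X$ is a causal net for every execution $X$, and (2) ${}^\bullet t={}^\bullet t'$ and $t^\bullet=t'^\bullet$ imply $t=t'$. An unravel net is complete if for every $t\in T$ there is a place $s_t\in S$ (a key-place) with ${}^\bullet s_t=\{t\}$, $s_t^\bullet=\emptyset$, and $|t^\bullet|>1$. A reversible unravel net is a tuple $N=\langle S,T,U,F,\mathsf m\rangle$ such that (1) $U\subseteq T$ and for every $u\in U$ there is a unique $t\in T\setminus U$ with ${}^\bullet u=t^\bullet$ and $u^\bullet={}^\bullet t$; and (2) the subnet $N|_{T\setminus U}$ is a complete unravel net and $\langle S,T,F,\mathsf m\rangle$ is safe.
   Formalization: Added hypothesis: every t in U has a key-place that is unmarked initially (automatic if t occurs in some execution). Without it the claim fails: preset {a,b}, postset {c,d}, initial marking {a,c,d}; t is dead, but its reverse can fire and puts two tokens in a. *)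

(* Defs.v *)
(* MathComp, with the classical sets of MathComp-Analysis. *)
From Stdlib Require Export Relation_Operators.
From mathcomp Require Export all_boot.
From mathcomp Require Export boolp classical_sets.

Set Implicit Arguments.
Unset Strict Implicit.
Unset Printing Implicit Defensive.

Local Open Scope classical_set_scope.

(* Places and transitions are drawn from two distinct types, which makes the
   two sets disjoint. The flow relation is split into its place-to-transition
   part [arc_in] and its transition-to-place part [arc_out]. Neither set is
   assumed finite, and a multiset over a type [A] is a function [A -> nat]. *)
Record net (P T : Type) := Net {
  places : set P;
  transitions : set T;
  arc_in : P -> T -> Prop;
  arc_out : T -> P -> Prop;
  marking : P -> nat
}.

Section Nets.
Variables P T : Type.
Implicit Types (N : net P T) (m : P -> nat) (t : T) (s : P) (w : seq T).

Definition preset N t : set P := [set s | arc_in N s t].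
Definition postset N t : set P := [set s | arc_out N t s].
Definition place_preset N s : set T := [set t | arc_out N t s].
Definition place_postset N s : set T := [set t | arc_in N s t].

Definition petri_net N : Prop :=
  [/\ forall s t, arc_in N s t -> places N s /\ transitions N t,
      forall t s, arc_out N t s -> transitions N t /\ places N s,
      forall s, marking N s <> 0 -> places N s &
      forall t, transitions N t -> preset N t !=set0].

Definition mset_of (A : Type) (X : set A) : A -> nat := fun x => x \in X.

Definition enabled N m t : Prop :=
  transitions N t /\ forall s, mset_of (preset N t) s <= m s.

Definition fire N m t : P -> nat :=
  fun s => m s - mset_of (preset N t) s + mset_of (postset N t) s.

Fixpoint firing_sequence N m w : Prop :=
  if w is t :: w' then enabled N m t /\ firing_sequence N (fire N m t) w'
  else True.

Definition reachable N m : Prop :=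
  exists2 w, firing_sequence N (marking N) w & m = foldl (fire N) (marking N) w.

Definition mset_of_seq w : T -> nat := fun t => count (fun u => `[< u = t >]) w.

Definition execution N (X : T -> nat) : Prop :=
  exists2 w, firing_sequence N (marking N) w & X = mset_of_seq w.

Definition safe N : Prop :=
  petri_net N /\ forall m, reachable N m -> forall s, m s <= 1.

Definition subnet N (X : set T) : net P T :=
  let S' := \bigcup_(t in X) (preset N t `|` postset N t) in
  {| places := S';
     transitions := X;
     arc_in := fun s t => [/\ S' s, X t & arc_in N s t];
     arc_out := fun t s => [/\ X t, S' s & arc_out N t s];
     marking := fun s => if s \in S' then marking N s else 0 |}.

Definition flow N (x y : P + T) : Prop :=
  match x, y with
  | inl s, inr t => arc_in N s t
  | inr t, inl s => arc_out N t s
  | _, _ => False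
  end.

(* The reflexive pairs of F* are not cycles, hence the irreflexivity of F+. *)
Definition acyclic N : Prop := forall x, ~ clos_trans _ (flow N) x x.

Definition causal_net N : Prop :=
  [/\ safe N,
      forall s, places N s ->
        is_subset1 (place_preset N s) /\ is_subset1 (place_postset N s),
      acyclic N,
      execution N (mset_of (transitions N)) &
      forall s, places N s -> place_preset N s = set0 -> marking N s = 1].

Definition unravel_net N : Prop :=
  [/\ safe N,
      forall X, execution N X -> causal_net (subnet N [set t | 0 < X t]) &
      forall t t', transitions N t -> transitions N t' ->
        preset N t = preset N t' -> postset N t = postset N t' -> t = t'].

(* [~ is_subset1 A] says that A has more than one element. *)
Definition key_place N t s : Prop :=
  [/\ places N s,
      place_preset N s = [set t],
      place_postset N s = set0 &
      ~ is_subset1 (postset N t)].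

Definition complete_unravel_net N : Prop :=
  unravel_net N /\ forall t, transitions N t -> exists s, key_place N t s.

End Nets.

Record rnet (P T : Type) := RNet {
  base :> net P T;
  backward : set T
}.

Definition reversible_unravel_net (P T : Type) (N : rnet P T) : Prop :=
  [/\ backward N `<=` transitions N,
      forall u, backward N u ->
        exists! t, [/\ (transitions N `\` backward N) t,
                       preset N u = postset N t & postset N u = preset N t],
      complete_unravel_net (subnet N (transitions N `\` backward N)) &
      safe N].

(* The tags f (forward) and r (reverse). *)
Inductive dir := fwd | bwd.

Definition reversing (P T : Type) (N : net P T) (U : set T) : rnet P (T * dir) :=
  {| base :=
       {| places := places N;
          transitions := (transitions N `*` [set fwd]) `|` (U `*` [set bwd]);
          arc_in := fun s x => match x with
            | (t, fwd) => arc_in N s t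
            | (t, bwd) => arc_out N t s /\ U t
            end;
          arc_out := fun x s => match x with
            | (t, fwd) => arc_out N t s
            | (t, bwd) => arc_in N s t /\ U t
            end;
          marking := marking N |};
     backward := U `*` [set bwd] |}.

(* A token in a key-place of t is meant to record that t has fired. The
   definitions do not enforce this when t is dead: its key-places may then be
   marked initially, and reversing t can break safety, for example when
   preset t = {a, b}, postset t = {c, d} and the initial marking is {a, c, d}.
   The condition below excludes this. In a complete unravel net it holds
   whenever t occurs in some execution: the token that t puts in a key-place
   is never consumed, so by safety the key-place was empty initially. *)
Definition has_unmarked_key_place (P T : Type) (N : net P T) (t : T) : Prop :=
  exists2 s, key_place N t s & marking N s = 0.

(* Main.v *)
(* The forward part of the reversed net is, up to renaming of transitions and
   removal of isolated places, the original net. For safety, every marking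
   reachable in the reversed net is already reachable in the original one: when
   the reverse of t is enabled after a firing sequence w, the key-place of t
   shows that t occurs exactly once in w. No later transition of w consumes from
   t^•: in the causal net generated by w a place of t^• has no input but t, so
   the consumed token would still be missing at the end. Hence t can be erased
   from w, and this undoes t. *)
Require Import Defs.
From mathcomp Require Import zify.

Set Implicit Arguments.
Unset Strict Implicit.
Unset Printing Implicit Defensive.

Local Open Scope classical_set_scope.

(** * Extensionality of nets and of sets seen as multisets *)

Lemma net_ext (P T : Type) (A B : net P T) :
  (forall s, places A s <-> places B s) ->
  (forall t, transitions A t <-> transitions B t) ->
  (forall s t, arc_in A s t <-> arc_in B s t) ->
  (forall t s, arc_out A t s <-> arc_out B t s) ->
  marking A =1 marking B -> A = B.
Proof.
case: A B => pA tA iA oA mA [pB tB iB oB mB] /= hp ht hi ho hm.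
have -> : pA = pB by apply/funext => s; apply/propext.
have -> : tA = tB by apply/funext => t; apply/propext.
have -> : iA = iB by apply/funext => s; apply/funext => t; apply/propext.
have -> : oA = oB by apply/funext => t; apply/funext => s; apply/propext.
by have -> : mA = mB by apply/funext.
Qed.

Lemma mset_of_pos (A : Type) (X : set A) x : 0 < mset_of X x <-> X x.
Proof. by rewrite /mset_of lt0b in_setE. Qed.

Lemma eq_mset_of (A B : Type) (X : set A) (Y : set B) x y :
  (X x <-> Y y) -> mset_of X x = mset_of Y y.
Proof.
by move=> h; congr nat_of_bool; apply/idP/idP; rewrite !in_setE => /h.
Qed.

(** * Firing sequences and the undoing of a transition *)

Section Firing.
Variables (P T : Type) (N : net P T).
Implicit Types (m : P -> nat) (t u : T) (s : P) (w : seq T).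

Lemma firing_sequence_cat m w1 w2 :
  firing_sequence N m (w1 ++ w2) <->
  firing_sequence N m w1 /\ firing_sequence N (foldl (fire N) m w1) w2.
Proof.
elim: w1 m => [|t w1 IH] m /=; first by split=> // -[].
by rewrite IH; split=> [[? []]|[[]]].
Qed.

Lemma reachable_fire m t : reachable N m -> enabled N m t ->
  reachable N (fire N m t).
Proof.
case=> w hw -> ht; exists (w ++ [:: t]); last by rewrite foldl_cat.
by apply/firing_sequence_cat.
Qed.

(** Token balance at [s]. It is stated with sums on both sides because subtraction on [nat] is
    truncated; enabledness makes the subtraction in [fire] exact. *)
Lemma marking_equation m w s : firing_sequence N m w ->
  foldl (fire N) m w s + count (fun u => s \in preset N u) w =
  m s + count (fun u => s \in postset N u) w.
Proof.
elim: w m => [|t w IH] m //= [[_ /(_ s) ht] /IH].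
by rewrite /fire -/(mset_of (preset N t) s) -/(mset_of (postset N t) s); lia.
Qed.

Lemma mset_of_seq_pos w t : 0 < mset_of_seq w t -> firing_sequence N (marking N) w ->
  transitions N t.
Proof.
rewrite /mset_of_seq -has_count; elim: w (marking N) => //= u w IH m.
by case/orP => [/asboolP <- [[]]|/IH h [_ /h]].
Qed.

(** The effect of the reverse of [t], expressed in [N] itself. It is meaningful when [m] covers the
    postset of [t]. *)
Definition unfire t m : P -> nat :=
  fun s => m s - mset_of (postset N t) s + mset_of (preset N t) s.

Lemma fireK m t : enabled N m t -> unfire t (fire N m t) = m.
Proof.
by case=> _ ht; apply/funext => s; rewrite /unfire /fire; move: (ht s); lia.
Qed.

End Firing.

(** The tokens removed by [unfire] lie in places from which no transition of [w] consumes. Hence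
    each step stays enabled, commutes with [unfire], and leaves the postset of [t] covered. *)
Lemma unfire_firing_sequence (P : Type) (T : eqType) (N : net P T) t w m :
  {in w, forall u, preset N u `&` postset N t = set0} ->
  (forall s, mset_of (postset N t) s <= m s) -> firing_sequence N m w ->
  firing_sequence N (unfire N t m) w /\
  foldl (fire N) (unfire N t m) w = unfire N t (foldl (fire N) m w).
Proof.
elim: w m => [|u w IH] m //= hd hm [[uT hu] hw].
(* Disjointness in numerical form: with [hu] and [hm] it bounds the sum by [m s], so no subtraction
   below is truncated. *)
have hdu s : mset_of (preset N u) s + mset_of (postset N t) s <= 1.
  rewrite /mset_of; case: (boolP (s \in preset N u)) => [|_]; last exact: leq_b1.
  case: (boolP (s \in postset N t)); rewrite // !in_setE => h2 h1.
  by have : set0 s by rewrite -(hd u (mem_head _ _)).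
have comm : fire N (unfire N t m) u = unfire N t (fire N m u).
  apply/funext => s; rewrite /fire /unfire.
  by have := hdu s; have := hu s; have := hm s; lia.
have hd' : {in w, forall u, preset N u `&` postset N t = set0}.
  by move=> v vw; apply: hd; rewrite in_cons vw orbT.
have [s|h1 h2] := IH (fire N m u) hd' _ hw.
  by rewrite /fire; have := hdu s; have := hu s; have := hm s; lia.
rewrite comm; split=> //; split=> //; split=> // s.
by rewrite /unfire; have := hdu s; have := hu s; have := hm s; lia.
Qed.

(** Decidable equality on [T] allows a firing sequence to be split at an occurrence of [t], which is
    then erased. *)
Lemma reachable_unfire_eqType (P : Type) (T : eqType) (N : net P T) m t :
  complete_unravel_net N ->
  has_unmarked_key_place N t -> reachable N m ->
  (forall s, mset_of (postset N t) s <= m s) -> reachable N (unfire N t m).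
Proof.
move=> [[[_ Nsafe] Ncausal _] _] [k [_ kpre kpost _] k0] [w hw ->] {m} hm.
(* Only [t] produces on [k], and by [ku] nothing consumes from it, so the tokens added to [k] count
   the occurrences of [t]. *)
have kt u : (k \in postset N u) = (u == t).
  apply/idP/eqP => [|->]; rewrite in_setE; first move=> ku.
    by have : place_preset N k u by []; rewrite kpre.
  by have : place_preset N k t by rewrite kpre.
have kcount v : count (fun u => k \in postset N u) v = count_mem t v.
  exact: eq_count.
have ku u : (k \in preset N u) = false.
  apply/negbTE/negP; rewrite in_setE => ku.
  by have : place_postset N k u by []; rewrite kpost.
(* [k] is empty initially and marked at the end, since it lies in the postset of [t]. *)
have tw : t \in w.
  have := marking_equation k hw; rewrite k0.
  have := hm k; rewrite {1}/mset_of kt eqxx kcount -has_pred1 has_count; lia.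
case/splitPr: tw hw hm => w1 w2 hw; rewrite foldl_cat /= => hm.
have [hw1 [/= ht hw2]] := (firing_sequence_cat _ _ _ _).1 hw.
have r0 : reachable N (foldl (fire N) (marking N) w1) by exists w1.
move: (foldl _ _ w1) r0 ht hw2 hm => m0 r0 ht hw2 hm.
have m1_le1 := Nsafe _ (reachable_fire r0 ht).
have m1_ge s : mset_of (postset N t) s <= fire N m0 t s by apply: leq_addl.
have mf_le1 s : foldl (fire N) (fire N m0 t) w2 s <= 1.
  apply: Nsafe; case: r0 ht hw2 {hm m1_le1 m1_ge} => v hv -> ht hw2.
  by exists (v ++ t :: w2); rewrite ?foldl_cat ?firing_sequence_cat.
(* A second occurrence of [t] would put a second token on [k], against safety. *)
have tw2 : t \notin w2.
  apply/negP; rewrite -has_pred1 has_count.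
  have := marking_equation k hw2; rewrite kcount (eq_count ku) count_pred0.
  by have := mf_le1 k; have := m1_ge k; rewrite /mset_of kt eqxx /=; lia.
(* Suppose [u] consumes from [p] in the postset of [t]. In the causal net generated by [w'] the only
   input of [p] is [t], which is absent from [w2], so [p] is never refilled. By safety it held one
   token after [t], so it ends empty, against [hm]. *)
have hd : {in w2, forall u, preset N u `&` postset N t = set0}.
  move=> u uw2; rewrite -subset0 => p [pu pt].
  set w' := w1 ++ t :: w2 in hw.
  have wX v : v \in w' -> [set v | 0 < mset_of_seq w' v] v.
    by rewrite /= /mset_of_seq -has_count => vw; apply/hasP; exists v => //; apply/asboolP.
  have [_ conf _ _ _] := Ncausal _ (ex_intro2 _ _ w' hw erefl).
  have tw : t \in w' by rewrite mem_cat mem_head orbT.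
  have pK : places (subnet N [set v | 0 < mset_of_seq w' v]) p.
    by exists t; [apply: wX|right].
  have [one_in _] := conf p pK.
  have no_in : count (fun v => p \in postset N v) w2 = 0.
    apply/eqP; rewrite -leqn0 leqNgt -has_count; apply/negP => /hasP [v vw2].
    rewrite in_setE => pv; have vw : v \in w' by rewrite mem_cat in_cons vw2 !orbT.
    have vt : v = t by apply: one_in; split=> //; apply: wX.
    by move: tw2; rewrite -vt vw2.
  have some_out : 0 < count (fun v => p \in preset N v) w2.
    by rewrite -has_count; apply/hasP; exists u => //; rewrite in_setE.
  have := marking_equation p hw2; have := m1_le1 p; have := hm p.
  by have /mset_of_pos := pt; rewrite no_in; lia.
have [hw2' fw2] := unfire_firing_sequence hd m1_ge hw2.
(* Undoing [t] right after its firing gives back [m0], so [w2] fires directly from [m0]. *)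
rewrite -fw2 fireK // in hw2' *.
case: r0 hw2' {hm m1_le1 m1_ge fw2 hw2 ht mf_le1} => v hv -> hw2'.
by exists (v ++ w2); rewrite ?foldl_cat ?firing_sequence_cat.
Qed.

(** Classically every type carries an equality test, and [{classic T}] is [T] equipped with it. *)
Lemma reachable_unfire (P T : Type) (N : net P T) m t :
  complete_unravel_net N -> has_unmarked_key_place N t -> reachable N m ->
  (forall s, mset_of (postset N t) s <= m s) -> reachable N (unfire N t m).
Proof. exact: (@reachable_unfire_eqType P {classic T}). Qed.

(** * Reachable markings of the reversed net *)

Lemma petri_net_reversing (P T : Type) (N : net P T) (U : set T) :
  petri_net N -> (forall t, U t -> postset N t !=set0) ->
  petri_net (reversing N U).
Proof.
case=> hi ho hm hp hU; split=> //.
- move=> s [t []] /=; first by move/hi => [? ?]; split=> //; left.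
  by case=> /ho [? ?] ?; split=> //; right.
- move=> [t []] s /=; first by move/ho => [? ?]; split=> //; left.
  by case=> /hi [? ?] ?; split=> //; right.
- move=> [t d] /= [[/= tT ->]|[/= tU ->]]; first exact: hp.
  by have [s ts] := hU t tU; exists s.
Qed.

(** Reachability in [N] is an invariant: a forward step is a step of [N], and a reverse step is an
    [unfire]. *)
Lemma reversing_reachable (P T : Type) (N : net P T) (U : set T) m :
  complete_unravel_net N -> (forall t, U t -> has_unmarked_key_place N t) ->
  reachable (reversing N U) m -> reachable N m.
Proof.
move=> Nc Uk [w hw ->].
(* The induction starts from an arbitrary marking reachable in [N]. *)
have : reachable N (marking (reversing N U)) by exists [::].
elim: w (marking _) hw => [|[t d] w IH] // m' [] [tT ht] hw r /=.
apply: IH => //; case: d tT ht {hw} => -[] [/= tT dE] // ht.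
  exact: reachable_fire.
have mE s : (s \in preset (reversing N U) (t, bwd)) = (s \in postset N t).
  by apply/idP/idP; rewrite !in_setE; [case|].
have pE s : (s \in postset (reversing N U) (t, bwd)) = (s \in preset N t).
  by apply/idP/idP; rewrite !in_setE; [case|].
have -> : fire (reversing N U) m' (t, bwd) = unfire N t m'.
  by apply/funext => s; rewrite /fire /unfire /mset_of mE pE.
by apply: reachable_unfire (Uk _ tT) r _ => // s; rewrite /mset_of -mE; apply: ht.
Qed.

(** * Subnets of subnets *)

Section Subnet.
Variables (P T : Type) (N : net P T).
Implicit Types (m : P -> nat) (t : T) (w : seq T) (X : set T).

Lemma preset_subnet X t : X t -> preset (subnet N X) t = preset N t.
Proof.
by move=> Xt; apply/seteqP; split=> s /= => [[]//|st]; split=> //; exists t => //; left.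
Qed.

Lemma postset_subnet X t : X t -> postset (subnet N X) t = postset N t.
Proof.
by move=> Xt; apply/seteqP; split=> s /= => [[]//|st]; split=> //; exists t => //; right.
Qed.

Lemma bigcup_subnet X Y : X `<=` Y ->
  \bigcup_(t in X) (preset (subnet N Y) t `|` postset (subnet N Y) t) =
  \bigcup_(t in X) (preset N t `|` postset N t).
Proof.
by move=> XY; apply: eq_bigcupr => t /XY Yt; rewrite preset_subnet ?postset_subnet.
Qed.

Lemma subnet_subnet X Y : X `<=` Y -> subnet (subnet N Y) X = subnet N X.
Proof.
move=> XY; have sS := bigcup_subset XY (F := fun t => preset N t `|` postset N t).
apply: net_ext => //.
- by move=> s; rewrite [places _]bigcup_subnet.
- move=> s t; split.
    by case; rewrite bigcup_subnet // => ? ? [].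
  by case=> ? ? ?; split; rewrite ?bigcup_subnet //; split; auto.
- move=> t s; split.
    by case=> ?; rewrite bigcup_subnet // => ? [].
  by case=> ? ? ?; split; rewrite ?bigcup_subnet //; split; auto.
move=> s /=; rewrite bigcup_subnet //; case: ifPn => //; rewrite in_setE => /sS h.
by rewrite ifT // in_setE.
Qed.

End Subnet.

(** * The subnet generated by all transitions *)

Section SubnetTransitions.
Variables (P T : Type) (N : net P T).
Hypothesis N_petri : petri_net N.

Let M := subnet N (transitions N).
(** [M] lacks only the isolated places of [N], and [restrict] empties them. Firing never touches
    them, so a sequence fires from [m] in [N] exactly when it fires from [restrict m] in [M]. *)
Let restrict (m : P -> nat) : P -> nat :=
  fun s => if s \in places M then m s else 0.

Let places_preset t s : transitions N t -> preset N t s -> s \in places M.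
Proof. by move=> tT st; rewrite in_setE; exists t => //; left. Qed.

Let places_postset t s : transitions N t -> postset N t s -> s \in places M.
Proof. by move=> tT st; rewrite in_setE; exists t => //; right. Qed.

Let restrict_enabled m t : enabled M (restrict m) t <-> enabled N m t.
Proof.
split=> -[tT h]; split=> // s; move: (h s); rewrite /restrict preset_subnet //.
  by case: ifP => // _; rewrite leqn0 => /eqP ->.
case: ifPn => // sM _; rewrite leqn0 eqb0.
by apply/negP; rewrite in_setE => /(places_preset tT); apply/negP.
Qed.

Let restrict_fire m t : transitions N t ->
  fire M (restrict m) t = restrict (fire N m t).
Proof.
move=> tT; apply/funext => s.
rewrite /fire /restrict preset_subnet // postset_subnet //; case: ifPn => // sM.
rewrite sub0n add0n; apply/eqP; rewrite eqb0.
by apply/negP; rewrite in_setE => /(places_postset tT); apply/negP.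
Qed.

Let restrict_firing_sequence m w :
  firing_sequence M (restrict m) w <-> firing_sequence N m w.
Proof.
elim: w m => [|t w IH] m //=; rewrite restrict_enabled.
by split=> -[tm]; have [tT _] := tm; rewrite restrict_fire // => /IH.
Qed.

Let restrict_foldl m w : firing_sequence N m w ->
  foldl (fire M) (restrict m) w = restrict (foldl (fire N) m w).
Proof. by elim: w m => [|t w IH] m //= [[tT _] /IH <-]; rewrite restrict_fire. Qed.

Lemma subnet_transitions_execution X : execution M X <-> execution N X.
Proof.
by split=> -[w hw ->]; exists w => //; apply/(restrict_firing_sequence (marking N) w).
Qed.

Lemma petri_net_subnet : petri_net M.
Proof.
case: N_petri => hi ho _ hp; split.
- by move=> s t [].
- by move=> t s [].
- by move=> s /=; case: ifP => //; rewrite in_setE.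
- by move=> t tT; rewrite preset_subnet //; apply: hp.
Qed.

Lemma safe_subnet_transitions : safe N -> safe M.
Proof.
case=> _ Ns; split; first exact: petri_net_subnet.
move=> _ [w /(restrict_firing_sequence (marking N) w) hw ->] s.
by rewrite (restrict_foldl hw) /restrict; case: ifP => // _; apply: Ns; exists w.
Qed.

Lemma complete_subnet_transitions : complete_unravel_net N -> complete_unravel_net M.
Proof.
case=> -[Ns Ncausal Ninj] Nkey; split; first split.
- exact: safe_subnet_transitions.
- move=> X /subnet_transitions_execution XN; rewrite subnet_subnet; first exact: Ncausal.
  by case: XN => w hw -> t /= tw; apply: mset_of_seq_pos tw hw.
- by move=> t t' tT tT'; rewrite !preset_subnet // !postset_subnet //; apply: Ninj.
- move=> t tT; have [s [sP spre spost tk]] := Nkey t tT; exists s.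
  (* A key-place of [t] receives an arc from [t], so it is not isolated and survives in [M]. *)
  have ts : postset N t s by have : place_preset N s t by rewrite spre.
  have sM : places M s by exists t => //; right.
  split=> //; last by rewrite postset_subnet.
    apply/seteqP; split=> u; first by case=> _ _ us; rewrite -spre.
    by move=> /= ->; split.
  by rewrite -subset0 -spost => u [].
Qed.

End SubnetTransitions.

(** * Invariance under an injective renaming of transitions *)

Section Relabel.
Variables (P T T' : Type) (f : T -> T').
Hypothesis f_inj : injective f.
Implicit Types (N : net P T) (X : set T).

(** Arcs are taken as images, so [f] need not be onto; elements outside its range carry no arc. *)
Definition relabel N : net P T' :=
  {| places := places N;
     transitions := f @` transitions N;
     arc_in := fun s x => exists2 t, arc_in N s t & f t = x;
     arc_out := fun x s => exists2 t, arc_out N t s & f t = x;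
     marking := marking N |}.

Lemma preset_relabel N t : preset (relabel N) (f t) = preset N t.
Proof. by apply/seteqP; split=> s /= => [[u us /f_inj <-]|]; last exists t. Qed.

Lemma postset_relabel N t : postset (relabel N) (f t) = postset N t.
Proof. by apply/seteqP; split=> s /= => [[u us /f_inj <-]|]; last exists t. Qed.

Lemma place_preset_relabel N s : place_preset (relabel N) s = f @` place_preset N s.
Proof. by []. Qed.

Lemma place_postset_relabel N s : place_postset (relabel N) s = f @` place_postset N s.
Proof. by []. Qed.

Lemma fire_relabel N m t : fire (relabel N) m (f t) = fire N m t.
Proof. by rewrite /fire preset_relabel postset_relabel. Qed.

Lemma enabled_relabel N m t : enabled (relabel N) m (f t) <-> enabled N m t.
Proof.
rewrite /enabled preset_relabel; split=> -[tT h]; split=> //.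
  by case: tT => u uT /f_inj <-.
by exists t.
Qed.

Lemma foldl_fire_relabel N m w :
  foldl (fire (relabel N)) m (map f w) = foldl (fire N) m w.
Proof. by elim: w m => //= t w IH m; rewrite fire_relabel IH. Qed.

Lemma firing_sequence_relabel N m w :
  firing_sequence (relabel N) m (map f w) <-> firing_sequence N m w.
Proof. by elim: w m => //= t w IH m; rewrite enabled_relabel fire_relabel IH. Qed.

(** An enabled transition belongs to the net, hence to the image of [f]. *)
Lemma firing_sequence_relabelP N m w' :
  firing_sequence (relabel N) m w' -> exists w, w' = map f w.
Proof.
elim: w' m => [|x w' IH] m /=; first by exists [::].
by case=> -[[t _ <-] _] /IH [w ->]; exists (t :: w).
Qed.

Lemma reachable_relabel N m : reachable (relabel N) m -> reachable N m.
Proof.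
case=> w' hw' ->; have [w wE] := firing_sequence_relabelP hw'.
exists w; last by rewrite wE foldl_fire_relabel.
by apply/firing_sequence_relabel; rewrite -wE.
Qed.

Lemma mset_of_seq_map w t : mset_of_seq (map f w) (f t) = mset_of_seq w t.
Proof.
rewrite /mset_of_seq count_map; apply: eq_count => u /=.
by apply/asboolP/asboolP => [/f_inj|->].
Qed.

Lemma mset_of_seq_map_pos w x : 0 < mset_of_seq (map f w) x -> (range f) x.
Proof.
rewrite /mset_of_seq -has_count has_map; elim: w => //= t w IH.
by case/orP => [/asboolP <-|/IH //]; exists t.
Qed.

Lemma petri_net_relabel N : petri_net N -> petri_net (relabel N).
Proof.
case=> hi ho hm hp; split=> //.
- by move=> s x [t /hi [? ?] <-]; split=> //; exists t.
- by move=> x s [t /ho [? ?] <-]; split=> //; exists t.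
- by move=> _ [t tT <-]; rewrite preset_relabel; apply: hp.
Qed.

Lemma safe_relabel N : safe N -> safe (relabel N).
Proof.
case=> Np Ns; split; first exact: petri_net_relabel.
by move=> m /reachable_relabel; apply: Ns.
Qed.

Lemma is_subset1_image X : is_subset1 X -> is_subset1 (f @` X).
Proof. by move=> X1 _ _ [t tX <-] [u uX <-]; rewrite (X1 t u). Qed.

(** The arcs are the images of those of [N] under the injective map [g] on nodes, so a cycle lifts
    to a cycle of [N]. *)
Lemma acyclic_relabel N : acyclic N -> acyclic (relabel N).
Proof.
pose g (x : P + T) : P + T' := match x with inl s => inl s | inr t => inr (f t) end.
have g_inj : injective g by move=> [s|t] [s'|t'] //= [] => [->|/f_inj ->].
have flowP x y : flow (relabel N) x y ->
    exists a b, [/\ x = g a, y = g b & flow N a b].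
  case: x y => [s|x] [s'|y] //= [t st <-].
    by exists (inl s), (inr t).
  by exists (inr t), (inl s').
have flowtP x y : clos_trans _ (flow (relabel N)) x y ->
    exists a b, [/\ x = g a, y = g b & clos_trans _ (flow N) a b].
  elim=> {x y} [x y /flowP [a [b [-> -> ab]]]|x y z _ [a [b [-> -> ab]]] _].
    by exists a, b; split=> //; apply: t_step.
  (* Injectivity of [g] identifies the two lifts of the middle node, so the lifted paths compose. *)
  case=> [b' [c [/g_inj <- -> bc]]].
  by exists a, c; split=> //; apply: t_trans ab bc.
move=> Na x /flowtP [a [b [-> /g_inj <-]]]; exact: Na.
Qed.

Lemma causal_net_relabel N : causal_net N -> causal_net (relabel N).
Proof.
case=> Ns conf Na [w hw Xw] Nm; split.
- exact: safe_relabel.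
- by move=> s /conf [? ?]; split; apply: is_subset1_image.
- exact: acyclic_relabel.
- exists (map f w); first exact/firing_sequence_relabel.
  (* Off the range of [f] both multisets vanish. *)
  apply/funext => x; have [[t _ <-]|xNf] := pselect (range f x).
    rewrite mset_of_seq_map -Xw; apply: eq_mset_of.
    by split=> [[u uT /f_inj <-]|tT] //; exists t.
  transitivity 0.
    by apply/eqP; rewrite eqb0; apply/negP; rewrite in_setE => -[t _ tx]; apply: xNf; exists t.
  by apply/esym/eqP; rewrite -leqn0 leqNgt; apply/negP => /mset_of_seq_map_pos.
- move=> s sP; rewrite place_preset_relabel => /image_set0_set0; exact: Nm.
Qed.

Lemma subnet_relabel N X : subnet (relabel N) (f @` X) = relabel (subnet N X).
Proof.
have SE : \bigcup_(x in f @` X) (preset (relabel N) x `|` postset (relabel N) x) =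
          \bigcup_(t in X) (preset N t `|` postset N t).
  rewrite bigcup_image; apply: eq_bigcupr => t _.
  by rewrite preset_relabel postset_relabel.
apply: net_ext => //.
- by move=> s; rewrite [places _]SE.
- move=> s x; split=> [[]|[t [sS tX st] <-]].
    by rewrite SE => sS [t tX <-] [u us /f_inj tu]; subst u; exists t.
  by split; rewrite ?SE //; exists t.
- move=> x s; split=> [[]|[t [tX sS ts] <-]].
    by rewrite SE => -[t tX <-] sS [u us /f_inj tu]; subst u; exists t.
  by split; rewrite ?SE //; exists t.
- by move=> s /=; rewrite SE.
Qed.

Lemma complete_relabel N : complete_unravel_net N -> complete_unravel_net (relabel N).
Proof.
case=> -[Ns Ncausal Ninj] Nkey; split; first split.
- exact: safe_relabel.
- move=> X [w' hw' ->]; have [w wE] := firing_sequence_relabelP hw'.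
  rewrite wE in hw' *; move/firing_sequence_relabel in hw'.
  (* The generated subnet thus becomes the renaming of a causal subnet of [N]. *)
  have -> : [set x | 0 < mset_of_seq (map f w) x] = f @` [set t | 0 < mset_of_seq w t].
    apply/seteqP; split=> [x /= xw|_ [t /= tw <-]]; last by rewrite /= mset_of_seq_map.
    have [t _ tx] := mset_of_seq_map_pos xw; subst x.
    by exists t => //=; rewrite -mset_of_seq_map.
  by rewrite subnet_relabel; apply: causal_net_relabel; apply: Ncausal; exists w.
- move=> _ _ [t tT <-] [t' tT' <-]; rewrite !preset_relabel !postset_relabel => h1 h2.
  by rewrite (Ninj t t').
- move=> _ [t tT <-]; have [s [sP spre spost tk]] := Nkey t tT; exists s; split=> //.
  + by rewrite place_preset_relabel spre image_set1.
  + by rewrite place_postset_relabel spost image_set0.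
  + by rewrite postset_relabel.
Qed.

End Relabel.

(** * The forward part of the reversed net, and the conclusion *)

Lemma subnet_reversing_forward (P T : Type) (N : net P T) (U : set T) :
  petri_net N ->
  subnet (reversing N U) (transitions (reversing N U) `\` backward (reversing N U)) =
  relabel (fun t => (t, fwd)) (subnet N (transitions N)).
Proof.
move=> Np.
have fI : injective (fun t : T => (t, fwd)) by move=> t u [].
have -> : transitions (reversing N U) `\` backward (reversing N U) =
          (fun t => (t, fwd)) @` transitions N.
  apply/seteqP; split=> [[t d] /= [[[/= tT ->]|//] _]|_ [t tT <-]]; first by exists t.
  by split=> /=; [left|case].
rewrite -subnet_relabel //.
(* On forward transitions the reversed net and the renamed net have the same presets and postsets,
   so both subnets have the same places. *)
have SE : \bigcup_(x in (fun t => (t, fwd)) @` transitions N)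
            (preset (reversing N U) x `|` postset (reversing N U) x) =
          \bigcup_(x in (fun t => (t, fwd)) @` transitions N)
            (preset (relabel (fun t => (t, fwd)) N) x `|`
             postset (relabel (fun t => (t, fwd)) N) x).
  rewrite !bigcup_image; apply: eq_bigcupr => t _.
  by rewrite preset_relabel // postset_relabel.
apply: net_ext => //.
- by move=> s; rewrite [places _]SE.
- move=> s x; split=> -[]; first by rewrite SE => ? [t tT <-] st; split=> //; exists t.
  by rewrite -SE => ? [t tT <-] [u us [ut]]; subst u; split=> //; exists t.
- move=> x s; split=> -[]; first by rewrite SE => -[t tT <-] ? st; split=> //; exists t.
  by rewrite -SE => -[t tT <-] ? [u us [ut]]; subst u; split=> //; exists t.
- by move=> s /=; rewrite SE.
Qed.

Theorem proposition3p12 (P T : Type) (N : net P T) (U : set T)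
    (N_complete : complete_unravel_net N)
    (U_sub : (U `<=` transitions N)%classic)
    (U_unmarked : forall t, U t -> has_unmarked_key_place N t) :
  reversible_unravel_net (reversing N U).
Proof.
have [[[Np Ns] _ Ninj] Nkey] := N_complete.
split.
- by move=> x xU; right.
(* The reverse of [u] is matched with [(u, fwd)]; uniqueness is condition (2) of unravel nets. *)
- move=> [u d] [/= uU ->]; exists (u, fwd); split.
    split; first by split; [left; split=> //; apply: U_sub|case].
    + by apply/seteqP; split=> s //= -[].
    + by apply/seteqP; split=> s //= -[].
  move=> [t e] [[[[/= tT ->]|//] _] ut tu]; congr pair.
  apply: Ninj => //; first exact: U_sub.
    by rewrite -[RHS]tu; apply/seteqP; split=> s /=; [move=> us; split|case].
  by rewrite -[RHS]ut; apply/seteqP; split=> s /=; [move=> us; split|case].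
- rewrite subnet_reversing_forward //; apply: complete_relabel; first by move=> ? ? [].
  exact: complete_subnet_transitions.
split; last by move=> m /(reversing_reachable N_complete U_unmarked); apply: Ns.
(* The reverse of [t] has a non-empty preset because the key-place lies in the postset of [t]. *)
apply: petri_net_reversing => // t /U_unmarked [s [_ spre _ _] _].
by exists s; have : place_preset N s t by rewrite spre.
Qed.
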